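(* Let $m\ge 3$ and $n\ge 3$ (with $m\le\binom n2$). Then a generic algebra $\mathfrak n\in N(m,n)$ is rigid.
   Context: Work over $\mathbb R$ or $\mathbb C$. For a vector space $\mathfrak n_{-1}$ of dimension $n$ and $0\le m\le\binom n2$, $N(m,n)$ denotes the space of graded 2-step nilpotent Lie algebra structures $\mathfrak n=\mathfrak n_{-2}\oplus\mathfrak n_{-1}$ with $\dim\mathfrak n_{-2}=m$, where the bracket $\Lambda^2\mathfrak n_{-1}\to\mathfrak n_{-2}$ is surjective and $\mathfrak n_{-2}$ is central; it is identified with the Grassmannian $\operatorname{Gr}_d(\Lambda^2\mathfrak n_{-1})$, $d=\binom n2-m$, by associating to the bracket its kernel $Z\subset\Lambda^2\mathfrak n_{-1}$ (conversely $\mathfrak n_{-2}=\Lambda^2\mathfrak n_{-1}/Z$). ''Generic'' means: for $Z$ in a nonempty Zariski open subset of this Grassmannian. The Tanaka prolongation of $\mathfrak n$ is the maximal graded Lie algebra $\hat{\mathfrak n}=\bigoplus_{i\ge -2}\hat{\mathfrak n}_i$ with negative part equal to $\mathfrak n$ such that for $k\ge0$ any $X\in\hat{\mathfrak n}_k$ with $[X,\mathfrak n_{-1}]=0$ is zero; $\mathfrak n$ is rigid if $\hat{\mathfrak n}$ is finite dimensional. *)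

(* Defs.v *)
From HB Require Import structures.
From mathcomp Require Import all_boot all_order all_algebra.
From mathcomp Require Import reals complex mpoly.
Set Implicit Arguments. Unset Strict Implicit. Unset Printing Implicit Defensive.
Import Order.TTheory GRing.Theory Num.Theory.
Local Open Scope ring_scope.

Section Tanaka.
Variables (K : fieldType) (m n : nat).

(* Bracket data: the bracket Lambda^2 n_{-1} -> n_{-2}, with n_{-1} = K^n and
   n_{-2} = K^m, given in coordinates by m skew-symmetric n x n matrices:
   the a-th coordinate of [v, w] is  v * c a * w^T. *)
Definition bracket_data := 'I_m -> 'M[K]_n.

Definition skew (c : bracket_data) : Prop := forall a, (c a)^T = - c a.

Definition brk (c : bracket_data) (v w : 'rV[K]_n) : 'rV[K]_m :=
  \row_a (v *m c a *m w^T) 0 0.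

(* surjectivity of the induced map Lambda^2 n_{-1} -> n_{-2}:
   every z is the image of some element  sum_{i,j} x_ij e_i /\ e_j. *)
Definition brk_surj (c : bracket_data) : Prop :=
  forall z : 'rV[K]_m, exists x : 'I_n -> 'I_n -> K,
    z = \sum_i \sum_j x i j *: brk c (delta_mx 0 i) (delta_mx 0 j).

(* Graded pieces of the (Tanaka) prolongation, indexed by degree + 2:
   G 0 = n_{-2}, G 1 = n_{-1}, and for k >= 0 the degree-k piece consists of
   pairs (phi1, phi2) of maps  n_{-1} -> g_{k-1},  n_{-2} -> g_{k-2}. *)
Fixpoint G (i : nat) : Type :=
  match i with
  | 0 => 'rV[K]_m
  | S i' => match i' with
            | 0 => 'rV[K]_n
            | S k => ((('rV[K]_n -> G i') * ('rV[K]_m -> G k))%type)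
            end
  end.

Fixpoint addG2 (k : nat) : (G k -> G k -> G k) * (G k.+1 -> G k.+1 -> G k.+1) :=
  match k return (G k -> G k -> G k) * (G k.+1 -> G k.+1 -> G k.+1) with
  | 0 => (fun x y : 'rV[K]_m => x + y, fun x y : 'rV[K]_n => x + y)
  | S k' => let (a0, a1) := addG2 k' in
      (a1, fun X Y : G k'.+2 => (fun v => a1 (X.1 v) (Y.1 v), fun w => a0 (X.2 w) (Y.2 w)))
  end.

Fixpoint scaleG2 (k : nat) : (K -> G k -> G k) * (K -> G k.+1 -> G k.+1) :=
  match k return (K -> G k -> G k) * (K -> G k.+1 -> G k.+1) with
  | 0 => (fun a (x : 'rV[K]_m) => a *: x, fun a (x : 'rV[K]_n) => a *: x)
  | S k' => let (s0, s1) := scaleG2 k' in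
      (s1, fun a (X : G k'.+2) => (fun v => s1 a (X.1 v), fun w => s0 a (X.2 w)))
  end.

Fixpoint zeroG2 (k : nat) : G k * G k.+1 :=
  match k return G k * G k.+1 with
  | 0 => (0 : 'rV[K]_m, 0 : 'rV[K]_n)
  | S k' => let (z0, z1) := zeroG2 k' in (z1, ((fun _ => z1), (fun _ => z0)) : G k'.+2)
  end.

Definition addG k := (addG2 k).1.
Definition scaleG k := (scaleG2 k).1.
Definition zeroG k := (zeroG2 k).1.

Definition brV (c : bracket_data) (k : nat) : G k.+1 -> 'rV[K]_n -> G k :=
  match k return G k.+1 -> 'rV[K]_n -> G k with
  | 0 => fun X w => brk c X w
  | S k' => fun X w => X.1 w
  end.

Definition brW (k : nat) (X : G k.+2) (w : 'rV[K]_m) : G k := X.2 w.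

Definition linV k (f : 'rV[K]_n -> G k) : Prop :=
  forall (a : K) v w, f (a *: v + w) = addG (scaleG a (f v)) (f w).
Definition linW k (f : 'rV[K]_m -> G k) : Prop :=
  forall (a : K) v w, f (a *: v + w) = addG (scaleG a (f v)) (f w).

(* The Tanaka (derivation) conditions for X = (phi1, phi2) of degree k >= 0:
   phi([x,y]) = [phi x, y] + [x, phi y] for x, y in n, using [x, Y] = -[Y, x]. *)
Definition tanaka_cond (c : bracket_data) (k : nat) (X : G k.+2) : Prop :=
  [/\
      forall v w, X.2 (brk c v w) = addG (brV c (X.1 v) w) (scaleG (-1) (brV c (X.1 w) v)),
      (* x in n_{-1}, y in n_{-2}  ([x,y] = 0) *)
      (match k return G k.+2 -> Prop with
       | 0 => fun _ => True
       | S k' => fun X => forall v w, brW (X.1 v) w = brV c (X.2 w) v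
       end) X
    & (* x, y in n_{-2}  ([x,y] = 0) *)
      (match k return G k.+2 -> Prop with
       | 0 | 1 => fun _ => True
       | S (S k'') => fun X => forall w w', brW (X.2 w) w' = brW (X.2 w') w
       end) X].

Fixpoint inG2 (c : bracket_data) (k : nat) : (G k -> Prop) * (G k.+1 -> Prop) :=
  match k return (G k -> Prop) * (G k.+1 -> Prop) with
  | 0 => (fun _ => True, fun _ => True)
  | S k' => let (P0, P1) := inG2 c k' in
      (P1, fun X : G k'.+2 =>
             [/\ @linV k'.+1 X.1, @linW k' X.2, (forall v, P1 (X.1 v)),
                 (forall w, P0 (X.2 w)) & tanaka_cond c X])
  end.

Definition in_prolong (c : bracket_data) (k : nat) (X : G k.+2) : Prop :=
  (inG2 c k.+2).1 X.

(* rigid: the Tanaka prolongation is finite dimensional, i.e. its graded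
   pieces \hat n_k vanish for all large k *)
Definition rigid (c : bracket_data) : Prop :=
  exists k0, forall k, (k0 <= k)%N -> forall X : G k.+2, in_prolong c X -> X = zeroG k.+2.

Definition coords (c : bracket_data) : 'I_(m * (n * n)) -> K :=
  fun p => mxvec (\matrix_(a < m) mxvec (c a)) 0 p.

(* "A generic algebra in N(m,n) is rigid": there is a nonempty Zariski open
   subset of the space of (skew) brackets, i.e. one containing the nonvanishing
   set of a polynomial P that does not vanish identically on the space, all of
   whose points are surjective brackets giving a rigid algebra. *)
Definition generic_rigid : Prop :=
  exists P : {mpoly K[m * (n * n)]},
    (exists c0, skew c0 /\ P.@[coords c0] != 0) /\
    forall c, skew c -> P.@[coords c] != 0 -> brk_surj c /\ rigid c.

End Tanaka.

(* Main.v *)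
(** A graded derivation of degree k of n is determined by the tensor of its
    iterated brackets with words e_i1 ... e_i(k+1) in n_{-1}.  Contraction with
    basis vectors acts on these tensors, and T_ij = [D_i, D_j], the bracket with
    [e_i, e_j], commutes with all D_l.
    - (Tanaka, in a special case) Suppose that h = {A : [Av,w] = [Aw,v]}, the
      degree-0 derivations trivial on n_{-2}, has zero first prolongation.  Then
      no nonzero tensor of positive degree is killed by all T_ij.  Dropping the
      conditions T_ij t = 0 one at a time, each space of solutions is in high
      degree mapped injectively by T = [D_i, D_j] to a finite-dimensional space,
      so that T is eventually bijective; as T commutes with D_i and D_j, taking
      traces gives dimension 0, exactly as for the Heisenberg relation
      [A, B] = 1 in characteristic 0.
    - The hypothesis on h, like surjectivity of the bracket, is the injectivity
      of a linear system whose coefficients are polynomial in the bracket, hence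
      Zariski open.
    - Both hold for a bracket whose first three components are supported on
      the edges of the n-cycle (even edges, odd edges, closing edge) and whose
      other components are single elements e_k /\ e_l. *)

Require Import Defs.
From HB Require Import structures.
From mathcomp Require Import all_boot all_order all_algebra.
From mathcomp Require Import boolp reals complex mpoly.
From mathcomp Require Import zify.
Set Implicit Arguments. Unset Strict Implicit. Unset Printing Implicit Defensive.
Import Order.TTheory GRing.Theory Num.Theory.
Local Open Scope ring_scope.

(** * Trace argument for Heisenberg relations *)

Lemma nonincreasing_stationary (s : nat -> nat) (k0 : nat) :
  (forall k, (k0 <= k)%N -> (s k.+1 <= s k)%N) ->
  exists2 k1, (k0 <= k1)%N & forall k, (k1 <= k)%N -> s k.+1 = s k.
Proof.
move: {2}(s k0) (leqnn (s k0)) => N.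
elim: N k0 => [|N IHN] k0 sk0 s_le.
  exists k0 => // k k0k.
  have s0 j : s (k0 + j)%N = 0%N.
    by elim: j => [|j IH]; [rewrite addn0; lia | have := s_le (k0 + j)%N; rewrite addnS; lia].
  by have := s0 (k - k0)%N; have := s0 (k.+1 - k0)%N; rewrite !subnKC; lia.
have [[k /andP[k0k lt_s]]|nlt] := pselect (exists k, (k0 <= k)%N && (s k.+1 < s k)%N).
  have s_mono j : (s (k0 + j)%N <= s k0)%N.
    by elim: j => [|j IH]; [rewrite addn0 | have := s_le (k0 + j)%N; rewrite addnS; lia].
  have sk : (s k <= s k0)%N by have := s_mono (k - k0)%N; rewrite subnKC.
  have [||k1 k1k Hk1] := IHN k.+1; [lia | by move=> j kj; apply: s_le; lia |].
  by exists k1 => //; lia.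
exists k0 => // k k0k; apply/eqP; rewrite eqn_leq s_le //= leqNgt.
by apply/negP => lt; apply: nlt; exists k; rewrite k0k.
Qed.

Section Trace.
Variable K : fieldType.
Hypothesis char0 : forall j, j.+1%:R != 0 :> K.

(* With [V k] the eventual inverse of [T k], the numbers [a k = tr (B A V)]
   satisfy [a k - a k.+1 = d k.+2] by cyclicity of the trace and [a k.+2 = a k]
   since [T] commutes with [A] and [B]. *)
Lemma heisenberg_dim0 (d : nat -> nat) (A B : forall k, 'M[K]_(d k.+1, d k))
    (T : forall k, 'M[K]_(d k.+2, d k)) (k0 : nat) :
  (forall k, T k = B k.+1 *m A k - A k.+1 *m B k) ->
  (forall k, T k.+1 *m A k = A k.+2 *m T k) ->
  (forall k, T k.+1 *m B k = B k.+2 *m T k) ->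
  (forall k, (k0 <= k)%N -> row_free (T k)) ->
  exists k1, forall k, (k1 <= k)%N -> d k = 0%N.
Proof.
move=> defT TA TB freeT.
have d_le k : (k0 <= k)%N -> (d k.+2 <= d k)%N.
  by move=> /freeT /eqP rT; rewrite -[X in (X <= _)%N]rT rank_leq_col.
(* Passing from [k] to [k.+1] replaces [d k] by [d k.+2] in this sum, so once it is stationary [d]
   has period 2 and every [T k] is square. *)
have [|k1 k01 Hk1] := @nonincreasing_stationary (fun k => d k + d k.+1)%N k0.
  by move=> k /d_le; lia.
have d2 k : (k1 <= k)%N -> d k.+2 = d k by move=> /Hk1; lia.
pose V k := pinvmx (T k).
have TV k : (k1 <= k)%N -> T k *m V k = 1%:M.
  by move=> k1k; apply: mulmxVp; apply: freeT; lia.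
have VT k : (k1 <= k)%N -> V k *m T k = 1%:M.
  move=> k1k; apply: mulVpmx; have /eqP rT : row_free (T k) by apply: freeT; lia.
  by rewrite /row_full rT d2.
move: V TV VT => V TV VT.
have VA k : (k1 <= k)%N -> V k.+1 *m A k.+2 = A k *m V k.
  move=> k1k; rewrite -[LHS]mulmx1 -(TV k) // mulmxA -[X in X *m _]mulmxA -TA.
  by rewrite mulmxA VT ?mul1mx //; lia.
have VB k : (k1 <= k)%N -> V k.+1 *m B k.+2 = B k *m V k.
  move=> k1k; rewrite -[LHS]mulmx1 -(TV k) // mulmxA -[X in X *m _]mulmxA -TB.
  by rewrite mulmxA VT ?mul1mx //; lia.
pose a k := \tr (B k.+1 *m A k *m V k).
have a_step k : (k1 <= k)%N -> a k - a k.+1 = (d k.+2)%:R.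
  move=> k1k; rewrite -(mxtrace1 K (d k.+2)) -(TV k) // defT mulmxBl.
  rewrite raddfB /=; congr (_ - _).
  by rewrite -[in RHS]mulmxA -VB // mulmxA mxtrace_mulC mulmxA.
have a_per k : (k1 <= k)%N -> a k.+2 = a k.
  move=> k1k; rewrite /a.
  have -> : B k.+3 = T k.+2 *m B k.+1 *m V k.+1.
    by rewrite TB -mulmxA TV ?mulmx1 //; lia.
  rewrite mxtrace_mulC !mulmxA VT ?mul1mx; last by lia.
  by rewrite -!mulmxA VA.
exists k1.+2 => k k1k.
have -> : k = (k - 2).+2 by lia.
have h1 : (k1 <= k - 2)%N by lia.
(* Two consecutive values of [a_step] telescope to a difference [a k - a k.+2], which is zero. *)
have : (d (k - 2).+2 + d (k - 2).+3)%:R == 0 :> K.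
  by rewrite natrD -!a_step ?a_per 1?leqW // -[X in _ + X]opprB subrr.
case E: (_ + _)%N => [|j]; last by rewrite (negPf (char0 j)).
by lia.
Qed.

(** A subspace of maximal dimension inside [P] absorbs every [x] satisfying [P], since adjoining the
    line of [x] stays inside [P]. *)
Lemma subspaceP (E : vectType K) (P : E -> Prop) :
  P 0 -> (forall a x y, P x -> P y -> P (a *: x + y)) ->
  exists U : {vspace E}, forall x, x \in U <-> P x.
Proof.
move=> P0 PD.
pose Q d := `[< exists2 U : {vspace E}, \dim U = d & forall x, x \in U -> P x >].
have exQ : exists d, Q d.
  by exists 0%N; apply/asboolP; exists 0%VS; rewrite ?dimv0 // => x; rewrite memv0 => /eqP ->.
have boundQ d : Q d -> (d <= \dim {:E})%N.
  by move=> /asboolP[U <- _]; apply: dimvS; apply: subvf.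
case: (ex_maxnP exQ boundQ) => d /asboolP[U dimU UP] dmax.
exists U => x; split=> [/UP //|Px].
have : Q (\dim (<[x]> + U)%VS).
  apply/asboolP; exists (<[x]> + U)%VS => // y /memv_addP[u /vlineP[a ->] [v /UP Pv ->]].
  exact: PD.
move=> /dmax; rewrite -dimU => le_dim.
have /eqP -> : (U == <[x]> + U)%VS by rewrite eqEdim addvSr.
by rewrite -{1}[x]addr0 memv_add ?memv_line ?mem0v.
Qed.

(** The trace argument for maps that preserve subspaces [P k]: coordinates in bases of these
    subspaces turn the relations, required on [P] only, into matrix identities. *)
Lemma heisenberg_vanish (E : nat -> vectType K)
    (A B : forall k, {linear E k.+1 -> E k}) (P : forall k, E k -> Prop) (k0 : nat) :
  (forall k, P k 0) -> (forall k a x y, P k x -> P k y -> P k (a *: x + y)) ->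
  (forall k t, P k.+1 t -> P k (A k t)) -> (forall k t, P k.+1 t -> P k (B k t)) ->
  let T k (t : E k.+2) := A k (B k.+1 t) - B k (A k.+1 t) in
  (forall k t, P k.+3 t -> A k (T _ t) = T _ (A _ t)) ->
  (forall k t, P k.+3 t -> B k (T _ t) = T _ (B _ t)) ->
  (forall k t, (k0 <= k)%N -> P k.+2 t -> T k t = 0 -> t = 0) ->
  exists k1, forall k t, (k1 <= k)%N -> P k t -> t = 0.
Proof.
move=> P0 PD PA PB T TA TB Tinj.
pose U k := projT1 (cid (subspaceP (P0 k) (@PD k))).
have UP k x : x \in U k <-> P k x by apply: (projT2 (cid (subspaceP (P0 k) (@PD k)))).
move: U UP => U UP.
pose d k := \dim (U k).
pose e k (x : 'rV[K]_(d k)) : E k := \sum_j x 0 j *: (vbasis (U k))`_j.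
pose f k (t : E k) : 'rV[K]_(d k) := \row_j coord (vbasis (U k)) j t.
have eU k x : P k (e k x).
  by apply/UP; apply: memv_suml => j _; apply/memvZ/vbasis_mem/mem_nth; rewrite size_tuple.
have fK k t : P k t -> e k (f k t) = t.
  by move=> /UP Ut; rewrite [RHS](coord_vbasis Ut); apply: eq_bigr => j _; rewrite mxE.
have eK k x : f k (e k x) = x.
  by apply/rowP => j; rewrite mxE coord_sum_free // (basis_free (vbasisP _)).
have eL k a x y : e k (a *: x + y) = a *: e k x + e k y.
  rewrite /e scaler_sumr -big_split /=; apply: eq_bigr => j _.
  by rewrite !mxE scalerDl scalerA.
have fL k a x y : f k (a *: x + y) = a *: f k x + f k y.
  by apply/rowP => j; rewrite !mxE linearP.
pose M k (g : {linear E k.+1 -> E k}) := \matrix_i f k (g (e k.+1 (delta_mx 0 i))).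
have ME k (g : {linear E k.+1 -> E k}) x : x *m M k g = f k (g (e k.+1 x)).
  pose h (y : 'rV_(d k.+1)) := f k (g (e k.+1 y)).
  have hL : linear h by move=> a y z; rewrite /h eL linearP fL.
  pose hl := GRing.isLinear.Build _ _ _ _ h hL.
  pose h' : {linear 'rV_(d k.+1) -> 'rV_(d k)} := HB.pack h hl.
  rewrite -[RHS]/(h' x) [in RHS](row_sum_delta x) linear_sum mulmx_sum_row.
  by apply: eq_bigr => j _; rewrite linearZ rowK.
have inj_mx p q (X Y : 'M[K]_(p, q)) : (forall x : 'rV_p, x *m X = x *m Y) -> X = Y.
  by move=> XY; apply/row_matrixP => i; rewrite !rowE XY.
have eM k (g : {linear E k.+1 -> E k}) x : (forall t, P k.+1 t -> P k (g t)) ->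
    e k (x *m M k g) = g (e k.+1 x).
  by move=> Pg; rewrite ME fK //; apply/Pg/eU.
pose Tm k := M k.+1 (B k.+1) *m M k (A k) - M k.+1 (A k.+1) *m M k (B k).
have eB k x y : e k (x - y) = e k x - e k y.
  by rewrite addrC -scaleN1r eL scaleN1r addrC.
have e0 k : e k 0 = 0.
  by rewrite /e big1 // => j _; rewrite mxE scale0r.
have TmE k x : e k (x *m Tm k) = T k (e k.+2 x).
  rewrite /Tm mulmxBr !mulmxA eB !eM //; by [apply: PA | apply: PB].
have e_inj k x y : e k x = e k y -> x = y by move=> /(congr1 (f k)); rewrite !eK.
have [| | | |k1 Hk1] := @heisenberg_dim0 d (fun k => M k (A k)) (fun k => M k (B k)) Tm k0.
- by [].
- move=> k; apply: inj_mx => x; apply: (e_inj); rewrite !mulmxA TmE eM; last exact: PA.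
  by rewrite TmE TA ?eM //; apply: PA.
- move=> k; apply: inj_mx => x; apply: (e_inj); rewrite !mulmxA TmE eM; last exact: PB.
  by rewrite TmE TB ?eM //; apply: PB.
- move=> k k0k; apply/inj_row_free => x /(congr1 (e k)); rewrite TmE e0 => Tx.
  by apply: e_inj; rewrite e0; apply: Tinj k0k _ Tx.
exists k1 => k t k1k Pt; rewrite -(fK _ _ Pt) /e big1 // => j _.
by have := ltn_ord j; rewrite [X in (_ < X)%N -> _]Hk1.
Qed.
End Trace.

(** * Tensors of iterated brackets *)

Section Tensor.
Variables (K : fieldType) (m n : nat).
Implicit Type c : bracket_data K m n.

Fixpoint tensor (k : nat) : vectType K :=
  match k with
  | 0 => 'rV[K]_n
  | k'.+1 => {ffun 'I_n -> tensor k'}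
  end.

Definition contract k (i : 'I_n) (t : tensor k.+1) : tensor k :=
  (t : {ffun 'I_n -> tensor k}) i.

Lemma contract_is_linear k i : linear (@contract k i).
Proof. by move=> a x y; rewrite /contract /= !ffunE. Qed.

HB.instance Definition _ k i :=
  GRing.isLinear.Build K (tensor k.+1) (tensor k) _ (@contract k i)
    (@contract_is_linear k i).

Lemma contract_eq0 k (t : tensor k.+1) : (forall i, contract i t = 0) -> t = 0.
Proof. by move=> t0; apply/ffunP => i; rewrite [LHS]t0 [RHS]ffunE. Qed.

(** By the derivation rule, this is the tensor of [[X, [e_i, e_j]]] when [t] is that of [X]. *)
Definition comm k (i j : 'I_n) (t : tensor k.+2) : tensor k :=
  contract j (contract i t) - contract i (contract j t).

Lemma comm_is_linear k i j : linear (@comm k i j).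
Proof. by move=> a x y; rewrite /comm !linearP /= addrACA -scalerDr. Qed.

HB.instance Definition _ k i j :=
  GRing.isLinear.Build K (tensor k.+2) (tensor k) _ (@comm k i j)
    (@comm_is_linear k i j).

Lemma comm_eq0 k i j (t : tensor k.+2) :
  comm i j t = 0 -> contract j (contract i t) = contract i (contract j t).
Proof. by move/eqP; rewrite subr_eq0 => /eqP. Qed.

Lemma brk_linear c a b x y w : brk c (a *: x + b *: y) w = a *: brk c x w + b *: brk c y w.
Proof.
apply/rowP => i; rewrite [LHS]mxE mulmxDl mulmxDl -!scalemxAl.
by rewrite [LHS]mxE ![in LHS]mxE [RHS]mxE ![in RHS]mxE.
Qed.

Definition bil c (x : tensor 0) (l : 'I_n) : 'rV[K]_m := brk c x (delta_mx 0 l).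

Lemma bilP c l a x y : bil c (a *: x + y) l = a *: bil c x l + bil c y l.
Proof. by rewrite /bil -[y]scale1r brk_linear !scale1r. Qed.

Lemma bil0 c l : bil c 0 l = 0.
Proof. by apply/rowP => i; rewrite [LHS]mxE !mul0mx !mxE. Qed.

(* The identity [[X, [e_i, e_j]], e_l] = [[X, e_l], [e_i, e_j]].  In degree 1 the
   right-hand side is the value on [e_i, e_j] of the derivation [X, e_l]. *)
Definition local c (k : nat) : tensor k.+1 -> Prop :=
  match k return tensor k.+1 -> Prop with
  | 0 => fun _ => True
  | 1 => fun t => forall i j l, bil c (@comm 0 i j t) l =
      bil c (contract i (contract l t)) j - bil c (contract j (contract l t)) i
  | k'.+2 => fun t => forall i j l, contract l (comm i j t) = comm i j (contract l t)
  end.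

Fixpoint good c (k : nat) : tensor k -> Prop :=
  match k return tensor k -> Prop with
  | 0 => fun _ => True
  | k'.+1 => fun t => (forall i, good c (contract i t)) /\ local c t
  end.

Lemma local_linear c k a (x y : tensor k.+1) :
  local c x -> local c y -> local c (a *: x + y).
Proof.
case: k x y => [|[|k]] x y //= lx ly i j l.
  rewrite !linearP !bilP lx ly /= opprD addrACA scalerBr; congr (_ + _).
by rewrite !linearP /= lx ly.
Qed.

Lemma good_linear c k a (x y : tensor k) : good c x -> good c y -> good c (a *: x + y).
Proof.
elim: k x y => [//|k IHk] x y [gx lx] [gy ly]; split; last exact: local_linear.
by move=> i; rewrite linearP; apply: IHk; [exact: gx | exact: gy].
Qed.

Lemma local0 c k : local c (0 : tensor k.+1).
Proof.
case: k => [|[|k]] //= i j l; last by rewrite !linear0.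
by rewrite !linear0 !bil0 subrr.
Qed.

Lemma good0 c k : good c (0 : tensor k).
Proof.
elim: k => [//|k IHk]; split; last exact: local0.
by move=> i; rewrite linear0.
Qed.

(* The first prolongation of the Lie algebra of [A] with [Av, w] = [Aw, v],
   i.e. of the degree-0 derivations that act trivially on n_{-2}, vanishes. *)
Definition no_vertical_prolong c :=
  forall t : 'I_n -> 'I_n -> 'rV[K]_n, (forall i j, t i j = t j i) ->
    (forall i j l, bil c (t i j) l = bil c (t i l) j) -> forall i j, t i j = 0.

(** In degree 1, vanishing commutators make [t] symmetric and turn [local] into the second
    hypothesis of [no_vertical_prolong]. In higher degree they pass to contractions, with which they
    commute. *)
Lemma good_comm0 c k (t : tensor k.+2) : no_vertical_prolong c ->
  good c t -> (forall i j, comm i j t = 0) -> t = 0.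
Proof.
move=> c0; elim: k t => [|k IHk] t gt t0.
  apply: contract_eq0 => i; apply: contract_eq0 => j.
  apply: (c0 (fun i j => contract j (contract i t))) => {}i {}j.
    exact: (@comm_eq0 0 _ _ t (t0 _ _)).
  move=> l; case: gt => _ /= /(_ j l i); rewrite t0 bil0.
  by move/esym/eqP; rewrite subr_eq0 => /eqP.
apply: contract_eq0 => i; apply: IHk; first by case: gt => gt _; apply: gt.
by move=> a b; case: gt => _ /= /(_ a b i) <-; rewrite t0 linear0.
Qed.

(** On good tensors killed by the pairs of [L], the commutator of one more pair [p] has zero kernel
    in high degree, so the trace argument removes [p]. *)
Lemma good_drop c (L : seq ('I_n * 'I_n)) : (forall j, j.+1%:R != 0 :> K) ->
  (exists k0, forall k (t : tensor k.+2), (k0 <= k)%N -> good c t ->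
     (forall p, p \in L -> comm p.1 p.2 t = 0) -> t = 0) ->
  exists k0, forall k (t : tensor k.+2), (k0 <= k)%N -> good c t -> t = 0.
Proof.
move=> char0; elim: L => [|p L IHL] [k0 H]; first by exists k0 => k t k0k gt; apply: H.
apply: IHL.
(* With this shift contractions start from [tensor k.+3], where [local] begins to say that they
   commute with commutators. *)
pose P k (t : tensor k.+2) := good c t /\ forall q, q \in L -> comm q.1 q.2 t = 0.
have PD l k t : P k.+1 t -> P k (contract l t).
  move=> [gt tL]; split=> [|q qL]; first by case: gt => gt _; apply: gt.
  by case: gt => _ /= /(_ q.1 q.2 l) <-; rewrite tL ?linear0.
have [| | | | | | |k1 Hk1] := @heisenberg_vanish K char0 (fun k => tensor k.+2)
  (fun k => @contract k.+2 p.2) (fun k => @contract k.+2 p.1) P k0.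
- by move=> k; split=> [|q _]; [exact: good0 | rewrite linear0].
- move=> k a x y [gx Lx] [gy Ly]; split; first exact: good_linear.
  by move=> q qL; rewrite (comm_is_linear q.1 q.2 a x y) Lx ?Ly // scaler0 addr0.
- by move=> k t; apply: PD.
- by move=> k t; apply: PD.
- by move=> k t [[_ lt] _]; apply: lt.
- by move=> k t [[_ lt] _]; apply: lt.
- move=> k t k0k [gt tL] t0; apply: (H k.+2) => //; first by lia.
  by move=> q; rewrite inE => /predU1P[-> //|]; apply: tL.
by exists k1 => k t k1k gt tL; apply: (Hk1 k).
Qed.

Lemma good_bounded c : (forall j, j.+1%:R != 0 :> K) -> no_vertical_prolong c ->
  exists k0, forall k (t : tensor k.+2), (k0 <= k)%N -> good c t -> t = 0.
Proof.
move=> char0 c0; apply: (good_drop (L := enum {: 'I_n * 'I_n})) => //.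
exists 0%N => k t _ gt t0; apply: (good_comm0 c0 gt) => i j.
by apply: (t0 (i, j)); rewrite mem_enum.
Qed.

End Tensor.

(** * Rigidity *)

Section Evaluation.
Variables (K : fieldType) (m n : nat) (c : bracket_data K m n).
Local Notation G := (G K m n).

Fixpoint to_tensor (k : nat) : G k.+1 -> tensor K n k :=
  match k return G k.+1 -> tensor K n k with
  | 0 => fun X => X
  | k'.+1 => fun X : G k'.+2 => [ffun i => @to_tensor k' (X.1 (delta_mx 0 i))]
  end.

Lemma contract_to_tensor k (X : G k.+2) i :
  contract i (to_tensor X) = to_tensor (X.1 (delta_mx 0 i)).
Proof. by rewrite /contract ffunE. Qed.

Lemma addGS k (X Y : G k.+2) :
  addG X Y = (fun v => @addG K m n k.+1 (X.1 v) (Y.1 v),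
              fun w => @addG K m n k (X.2 w) (Y.2 w)) :> G k.+2.
Proof. by rewrite /addG /=; case: (addG2 K m n k). Qed.

Lemma scaleGS k a (X : G k.+2) :
  scaleG a X = (fun v => @scaleG K m n k.+1 a (X.1 v),
                fun w => @scaleG K m n k a (X.2 w)) :> G k.+2.
Proof. by rewrite /scaleG /=; case: (scaleG2 K m n k). Qed.

Lemma zeroGS k :
  zeroG K m n k.+2 = (fun _ => zeroG K m n k.+1, fun _ => zeroG K m n k) :> G k.+2.
Proof. by rewrite /zeroG /=; case: (zeroG2 K m n k). Qed.

Lemma inGS k (X : G k.+2) : (inG2 c k.+2).1 X =
  [/\ @linV K m n k.+1 X.1, @linW K m n k X.2,
      (forall v, (inG2 c k.+1).1 (X.1 v)),
      (forall w, (inG2 c k).1 (X.2 w)) & tanaka_cond c X].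
Proof. by rewrite /=; case: (inG2 c k). Qed.

Lemma to_tensor_linear k a (X Y : G k.+1) :
  to_tensor (addG (scaleG a X) Y) = a *: to_tensor X + to_tensor Y.
Proof.
elim: k X Y => [//|k IHk] X Y; apply/ffunP => i.
rewrite addGS scaleGS !ffunE; exact: IHk.
Qed.

Lemma to_tensorB k (X Y : G k.+1) :
  to_tensor (addG X (scaleG (-1) Y)) = to_tensor X - to_tensor Y.
Proof.
elim: k X Y => [|k IHk] X Y; first by rewrite /addG /scaleG /= scaleN1r.
by apply/ffunP => i; rewrite addGS scaleGS !ffunE; exact: IHk.
Qed.

Lemma G_ind2 (P : forall k, G k -> Prop) :
  (forall X, P 0%N X) -> (forall X, P 1%N X) ->
  (forall k, (forall X, P k X) -> (forall X, P k.+1 X) -> forall X, P k.+2 X) ->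
  forall k X, P k X.
Proof.
move=> P0 P1 PS k; suff [] : (forall X, P k X) /\ (forall X, P k.+1 X) by [].
by elim: k => [//|k [IH0 IH1]]; split=> //; apply: PS.
Qed.

Lemma addNG k (X : G k) : addG (scaleG (-1) X) X = zeroG K m n k.
Proof.
move: k X; apply: G_ind2 => [X|X|k IH0 IH1 X].
- by rewrite /addG /scaleG /zeroG /= scaleN1r addNr.
- by rewrite /addG /scaleG /zeroG /= scaleN1r addNr.
rewrite addGS scaleGS zeroGS.
by congr pair; apply/funext => v; [exact: (IH1 (X.1 v)) | exact: (IH0 (X.2 v))].
Qed.

Lemma add0G k (X : G k) : addG (zeroG K m n k) X = X.
Proof.
move: k X; apply: G_ind2 => [X|X|k IH0 IH1 X].
- by rewrite /addG /zeroG /= add0r.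
- by rewrite /addG /zeroG /= add0r.
rewrite addGS zeroGS [RHS]surjective_pairing.
by congr pair; apply/funext => v; [exact: (IH1 (X.1 v)) | exact: (IH0 (X.2 v))].
Qed.

Lemma scaleG0 k a : scaleG a (zeroG K m n k) = zeroG K m n k.
Proof.
suff [] : scaleG a (zeroG K m n k) = zeroG K m n k /\
          scaleG a (zeroG K m n k.+1) = zeroG K m n k.+1 by [].
elim: k => [|k [IH0 IH1]]; first by rewrite /scaleG /zeroG /= !scaler0.
split=> //; rewrite scaleGS zeroGS.
by congr pair; apply/funext => v; [exact: IH1 | exact: IH0].
Qed.

Lemma brV0 k (w : 'rV_n) : brV c (zeroG K m n k.+1) w = zeroG K m n k.
Proof.
case: k => [|k]; last by rewrite /brV zeroGS.
by apply/rowP => i; rewrite [LHS]mxE !mul0mx !mxE.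
Qed.

(** [G k] carries no module structure, so linearity is exploited through [addNG], [scaleG0] and
    [add0G]. *)
Lemma linear_span_zero (p k : nat) (f : 'rV[K]_p -> G k) (I : finType)
    (x : I -> K) (v : I -> 'rV[K]_p) :
  (forall (a : K) v w, f (a *: v + w) = addG (scaleG a (f v)) (f w)) ->
  (forall i, f (v i) = zeroG K m n k) -> f (\sum_i x i *: v i) = zeroG K m n k.
Proof.
move=> fL fv; elim/big_ind: _ => [|a b fa fb|i _].
- by rewrite -[X in f X](addr0 (0 : 'rV_p)) -[X in X + _]oppr0 -scaleN1r fL addNG.
- by rewrite -[a]scale1r fL fa fb scaleG0 add0G.
have f0 : f 0 = zeroG K m n k.
  by rewrite -[in LHS](addNr (v i)) -scaleN1r fL fv scaleG0 add0G.
by rewrite -[_ *: _]addr0 fL fv f0 scaleG0 add0G.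
Qed.

Lemma to_tensor_bracket k (X : G k.+3) i j : tanaka_cond c X ->
  to_tensor (X.2 (brk c (delta_mx 0 i) (delta_mx 0 j)) : G k.+1) =
  comm i j (to_tensor X).
Proof. by move=> [-> _ _]; rewrite to_tensorB /comm !contract_to_tensor. Qed.

(** [local] is the Tanaka condition for the pair of [e_l] and [[e_i, e_j]], with brackets by
    [[e_i, e_j]] expanded by the derivation rule. *)
Lemma good_to_tensor k (X : G k.+1) : (inG2 c k.+1).1 X -> good c (to_tensor X).
Proof.
elim: k X => [//|k IHk] X; rewrite inGS => -[XL _ X1 X2 XT]; split.
  by move=> i; rewrite contract_to_tensor; apply: IHk.
case: k X XL X1 X2 XT {IHk} => [//|[|k]] X XL X1 X2 XT i j l.
  rewrite -to_tensor_bracket // !contract_to_tensor.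
  have [_ /(_ (delta_mx 0 l)) XW _] := XT.
  have := X1 (delta_mx 0 l); rewrite inGS => -[_ _ _ _ [XB _ _]].
  have := XW (brk c (delta_mx 0 i) (delta_mx 0 j)).
  rewrite /brW XB /addG /scaleG /= scaleN1r => XWe.
  exact: esym XWe.
rewrite -to_tensor_bracket // !contract_to_tensor.
have [_ /(_ (delta_mx 0 l)) XW _] := XT.
have := X1 (delta_mx 0 l); rewrite inGS => -[_ _ _ _ XB].
rewrite -[RHS]to_tensor_bracket //; congr to_tensor; exact: esym (XW _).
Qed.

(** [X.1] vanishes on basis vectors by induction; the derivation rule then kills [X.2] on brackets,
    which span by surjectivity. *)
Lemma to_tensor_eq0 k (X : G k.+1) : brk_surj c -> (inG2 c k.+1).1 X ->
  to_tensor X = 0 -> X = zeroG K m n k.+1.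
Proof.
move=> surj_c; elim: k X => [//|k IHk] X; rewrite inGS => -[XL1 XL2 X1 X2 [XB _ _]] X0.
have X10 v : X.1 v = zeroG K m n k.+1.
  rewrite (row_sum_delta v); apply: (@linear_span_zero n k.+1 X.1) => // i.
  apply: IHk => //; rewrite -[LHS]contract_to_tensor X0 linear0 //.
rewrite zeroGS [LHS]surjective_pairing; congr pair; apply/funext => z //.
have [x ->] := surj_c z; rewrite pair_big.
apply: (@linear_span_zero m k X.2 _ (fun p => x p.1 p.2)) => // p.
by rewrite XB !X10 !brV0 scaleG0 add0G.
Qed.

Lemma rigid_of_no_vertical_prolong : (forall j, j.+1%:R != 0 :> K) ->
  brk_surj c -> no_vertical_prolong c -> rigid c.
Proof.
move=> char0 surj_c c0; have [k0 Hk0] := good_bounded char0 c0.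
exists k0.+1 => -[//|k] k0k X XP; apply: to_tensor_eq0 => //.
by apply: Hk0 => //; apply: good_to_tensor.
Qed.
End Evaluation.

(** * Zariski openness *)

Section Genericity.
Variable K : fieldType.

(** Common form of both open conditions: [I] indexes the unknowns and [J] the equations of a
    homogeneous system. *)
Definition injective_at (N : nat) (I J : finType) (q : I -> J -> {mpoly K[N]})
    (v : 'I_N -> K) : Prop :=
  forall x : I -> K, (forall j, \sum_i x i * (q i j).@[v] = 0) -> forall i, x i = 0.

(* If [L] is a right inverse of the matrix [Q v0], then [det (Q v *m L)] is a
   polynomial in [v] with value 1 at [v0]. *)
Lemma injective_at_open (N : nat) (I J : finType) (q : I -> J -> {mpoly K[N]})
    (v0 : 'I_N -> K) : injective_at q v0 ->
  exists P : {mpoly K[N]}, P.@[v0] != 0 /\ forall v, P.@[v] != 0 -> injective_at q v.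
Proof.
move=> inj0.
pose Q := \matrix_(i < #|I|, j < #|J|) q (enum_val i) (enum_val j).
pose M v := map_mx (meval v) Q.
have ME v (x : 'rV_#|I|) j : (x *m M v) 0 (enum_rank j) =
    \sum_i x 0 (enum_rank i) * (q i j).@[v].
  rewrite mxE (reindex _ (onW_bij _ (@enum_rank_bij I))) /=.
  by apply: eq_bigr => i _; rewrite !mxE !enum_rankK.
have free_inj v : row_free (M v) <-> injective_at q v.
  split=> [freeM x xq i|inj].
    pose y := \row_s x (enum_val s) : 'rV[K]_#|I|.
    suff /rowP/(_ (enum_rank i)) : y = 0 by rewrite !mxE enum_rankK.
    apply/eqP; rewrite -(mulmx_free_eq0 _ freeM); apply/eqP/rowP => s.
    rewrite -(enum_valK s) ME mxE -[RHS](xq (enum_val s)).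
    by apply: eq_bigr => l _; rewrite mxE enum_rankK.
  apply/inj_row_free => x xM; apply/rowP => s; rewrite -(enum_valK s) [RHS]mxE.
  apply: (inj (fun i => x 0 (enum_rank i))) => j.
  by rewrite -ME xM mxE.
have /free_inj free0 := inj0.
pose L := pinvmx (M v0).
pose P := \det (Q *m map_mx (@mpolyC N K) L).
have PE v : P.@[v] = \det (M v *m L).
  rewrite /P -det_map_mx map_mxM -map_mx_comp; congr (\det (_ *m _)).
  by apply/matrixP => i j; rewrite mxE /= mevalC.
exists P; split; first by rewrite PE mulmxVp // det1 oner_neq0.
move=> v; rewrite PE => detP; apply/free_inj/inj_row_free => x xM.
have uML : M v *m L \in unitmx by rewrite unitmxE unitfE.
by rewrite -[x]mulmx1 -(mulmxV uML) !mulmxA xM !mul0mx.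
Qed.

Variables m n : nat.
Implicit Type c : bracket_data K m n.

Definition coordX (a : 'I_m) (k l : 'I_n) : {mpoly K[m * (n * n)]} :=
  'X_(mxvec_index a (mxvec_index k l)).

Lemma coordXE c a k l : (coordX a k l).@[coords c] = c a k l.
Proof. by rewrite mevalXU /coords mxvecE mxE mxvecE. Qed.

Definition bracket_eqs (a : 'I_m) (p : 'I_n * 'I_n) := coordX a p.1 p.2.

Lemma brkE c v (l : 'I_n) a : brk c v (delta_mx 0 l) 0 a = \sum_k v 0 k * c a k l.
Proof.
rewrite mxE mxE (bigD1 l) //= big1 => [|j /negPf jl]; last by rewrite !mxE jl andbF mulr0.
by rewrite !mxE !eqxx mulr1 addr0.
Qed.

(** The hypothesis is linear independence of the matrices [c a]; a right inverse of the matrix with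
    these rows gives preimages. *)
Lemma brk_surj_of_free c : injective_at bracket_eqs (coords c) -> brk_surj c.
Proof.
move=> inj z.
pose C := \matrix_a mxvec (c a) : 'M[K]_(m, n * n).
have freeC : row_free C.
  apply/inj_row_free => x xC; apply/rowP => a; rewrite [RHS]mxE.
  apply: (inj (fun a => x 0 a)) => -[k l].
  have /rowP/(_ (mxvec_index k l)) := xC; rewrite !mxE => E.
  rewrite -[RHS]E; apply: eq_bigr => b _.
  by rewrite /bracket_eqs coordXE mxE mxvecE.
pose y := z *m (pinvmx C)^T.
exists (fun i j => y 0 (mxvec_index i j)).
have zE : z = y *m C^T by rewrite /y -mulmxA -trmx_mul mulmxVp // trmx1 mulmx1.
apply/rowP => a; rewrite [in LHS]zE mxE pair_bigA summxE /=.
rewrite (reindex _ (curry_mxvec_bij n n)) /=; apply: eq_bigr => -[i j] _ /=.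
rewrite [in RHS]mxE brkE !mxE mxvecE; congr (_ * _).
rewrite (bigD1 i) //= mxE !eqxx mul1r big1 ?addr0 // => k /negPf ki.
by rewrite mxE ki andbF mul0r.
Qed.

(** The unknown [(i, j, k)] is the [k]-th coordinate of [t i j]; [inl] encodes symmetry of [t],
    [inr] the [a]-th coordinate of the bracket condition. *)
Definition vertical_eqs (s : 'I_n * 'I_n * 'I_n)
    (e : ('I_n * 'I_n * 'I_n) + ('I_n * 'I_n * 'I_n * 'I_m)) : {mpoly K[m * (n * n)]} :=
  match e with
  | inl (i, j, k) => (s == (i, j, k))%:R - (s == (j, i, k))%:R
  | inr (i, j, l, a) =>
      (s.1 == (i, j))%:R * coordX a s.2 l - (s.1 == (i, l))%:R * coordX a s.2 j
  end.

Lemma vertical_eqsE c (x : 'I_n * 'I_n * 'I_n -> K) e :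
  \sum_s x s * (vertical_eqs s e).@[coords c] =
  match e with
  | inl (i, j, k) => x (i, j, k) - x (j, i, k)
  | inr (i, j, l, a) =>
      \sum_k x (i, j, k) * c a k l - \sum_k x (i, l, k) * c a k j
  end.
Proof.
have delta (T : finType) (f : T -> K) t : \sum_s f s * (s == t)%:R = f t.
  rewrite (bigD1 t) //= eqxx mulr1 big1 ?addr0 // => s /negPf ->; exact: mulr0.
have part (i j : 'I_n) (f : 'I_n * 'I_n * 'I_n -> K) :
    \sum_s (s.1 == (i, j))%:R * f s = \sum_k f (i, j, k).
  rewrite (eq_bigr (fun s => (s.1 == (i, j))%:R * f (s.1, s.2))) => [|[] //].
  rewrite -(pair_bigA _ (fun u k => (u == (i, j))%:R * f (u, k))) /=.
  rewrite (bigD1 (i, j)) //= [X in _ + X]big1 ?addr0 => [|s /negPf ->];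
    last by rewrite big1 // => k _; rewrite mul0r.
  by apply: eq_bigr => k _; rewrite eqxx mul1r.
case: e => [[[i j] k]|[[[i j] l] a]] /=.
  rewrite -(delta _ x (i, j, k)) -(delta _ x (j, i, k)) -sumrB.
  by apply: eq_bigr => s _; rewrite mevalB !rmorph_nat mulrBr.
rewrite -(part i j (fun s => x s * c a s.2 l)) -(part i l (fun s => x s * c a s.2 j)).
rewrite -sumrB; apply: eq_bigr => s _.
by rewrite mevalB !mevalM !rmorph_nat !coordXE mulrBr ![x s * (_ * _)]mulrCA.
Qed.

Lemma no_vertical_prolongP c :
  injective_at vertical_eqs (coords c) <-> no_vertical_prolong c.
Proof.
split=> [inj t tsym tc i j|c0 x xq [[i j] k]].
  apply/rowP => k; rewrite [RHS]mxE.
  apply: (inj (fun s => t s.1.1 s.1.2 0 s.2) _ (i, j, k)) => e.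
  rewrite vertical_eqsE; case: e => [[[{}i {}j] {}k]|[[[{}i {}j] l] a]] /=.
    by rewrite tsym subrr.
  by rewrite -!brkE; apply/eqP; rewrite subr_eq0 -/(bil c _ _) tc.
pose t i j := \row_k x (i, j, k) : 'rV[K]_n.
suff /rowP/(_ k) : t i j = 0 by rewrite !mxE.
apply: c0 => {i j k} [i j|i j l].
  apply/rowP => k; rewrite !mxE; have := xq (inl (i, j, k)).
  by rewrite vertical_eqsE => /eqP; rewrite subr_eq0 => /eqP.
apply/rowP => a; rewrite !brkE.
have := xq (inr (i, j, l, a)); rewrite vertical_eqsE => /eqP; rewrite subr_eq0 => /eqP E.
under eq_bigr do rewrite mxE; rewrite E; by apply: eq_bigr => k _; rewrite mxE.
Qed.

Lemma generic_rigid_of_example c0 : (forall j, j.+1%:R != 0 :> K) -> Defs.skew c0 ->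
  injective_at bracket_eqs (coords c0) -> no_vertical_prolong c0 ->
  generic_rigid K m n.
Proof.
move=> char0 skew0 /injective_at_open[P1 [P10 HP1]].
move=> /no_vertical_prolongP/injective_at_open[P2 [P20 HP2]].
exists (P1 * P2); split; first by exists c0; rewrite mevalM mulf_neq0.
move=> c _; rewrite mevalM mulf_eq0 negb_or => /andP[/HP1 c1 /HP2 c2].
have surj_c := brk_surj_of_free c1; split=> //.
by apply: rigid_of_no_vertical_prolong => //; apply/no_vertical_prolongP.
Qed.
End Genericity.

(** * The cycle bracket *)

Section CycleJacobian.
Variables (V : zmodType) (n : nat).

(* These are the closedness conditions on the three 1-forms obtained by
   contracting a vector field with the forms of [cycle_form] below: [J p q] is the
   derivative along [e_p] of the component of index [q - 1].  The shift makes the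
   columns [0] and [n.+1] stand for components outside the range. *)
Definition cycle_rel (J : nat -> nat -> V) : Prop :=
  [/\ forall p, J p 0%N = 0 /\ J p n.+1 = 0,
      forall j l, (j < n)%N -> (l < n)%N -> odd j = odd l ->
        J j l = J l j /\ J j l.+2 = J l j.+2,
      forall j l, (j < n)%N -> (l < n)%N -> odd j != odd l -> J j l = - J l j.+2
    & forall j, (0 < j)%N -> (j.+1 < n)%N -> J j 1%N = 0 /\ J j n = 0].

(** For equal parities, [J p q.+2 = J q p.+2 = J p.+2 q]: moving along the antidiagonal reaches
    column 0 or 1, and [p + q < n] keeps indices in range. *)
Lemma cycle_rel_low J p q : cycle_rel J -> (p + q < n)%N -> odd p = odd q ->
  J p q = 0.
Proof.
case=> J0 Re Ro Jc; elim/ltn_ind: q p => -[|[|q]] IH p lt_pq pq.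
- by case: (J0 p).
- by case: (Jc p) => //; case: p pq lt_pq => //= p; lia.
have [|||_ ->] := Re p q; [lia | lia | by rewrite pq /= negbK |].
have [|||-> _] := Re q p.+2; [lia | lia | by rewrite /= pq /= !negbK|].
by apply: IH; rewrite /= ?pq /= ?negbK //; lia.
Qed.

(** The same walk in the other direction, ending in column [n] or [n.+1]. *)
Lemma cycle_rel_high J p q : cycle_rel J -> (p < n)%N -> (q <= n.+1)%N ->
  (n < p + q)%N -> odd p = odd q -> J p q = 0.
Proof.
case=> J0 Re Ro Jc; move E: (n.+1 - q)%N => d.
elim/ltn_ind: d p q E => d IH p q E pn qn lt_pq pq.
have [->|q1] := eqVneq q n.+1; first by case: (J0 p).
have [qn'|q2] := eqVneq q n.
  by rewrite qn'; case: (Jc p) => //; lia.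
have [|||-> _] := Re p q; [lia | lia | by []|].
case: p pn lt_pq pq => [|[|p]] pn lt_pq pq; [lia | lia |].
have [|||_ ->] := Re q p; [lia | lia | by rewrite -pq /= negbK |].
by apply: (IH (d - 2)%N); rewrite -?pq /= ?negbK //; lia.
Qed.

(** For opposite parities, [J p.+2 q.+2 = - J q p.+2 = J p q], so the walk follows the diagonal to
    column 0 or 1. In the corner [p = n - 1], [q = 1], one more exchange leads to column [n.+1]. *)
Lemma cycle_rel_below J p q : cycle_rel J -> (p < n)%N -> (q < p.+1)%N ->
  odd p != odd q -> J p q = 0.
Proof.
case=> J0 Re Ro Jc; elim/ltn_ind: p q => p IH [|[|q]] pn qp pq.
- by case: (J0 p).
- have [pn1|pn1] := eqVneq p.+1 n; last by case: (Jc p) => //; lia.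
  by rewrite Ro ?pn1 //; [case: (J0 1%N) => _ ->; rewrite oppr0 | lia].
rewrite -[LHS]opprK -(Ro q p); [|lia|lia|by move: pq => /=; rewrite negbK eq_sym].
case: p pn qp pq IH => [|[|p]] pn qp pq IH; [lia | lia |].
rewrite -(Ro p q); [|lia|lia|by move: pq => /=; rewrite !negbK].
by apply: IH; [lia|lia|lia|move: pq => /=; rewrite !negbK].
Qed.

(** The same diagonal walk stops at row 0 or 1, where one exchange leads to column 0 or 1. *)
Lemma cycle_rel_above J p q : cycle_rel J -> (p < n)%N -> (q <= n.+1)%N ->
  (p.+1 < q)%N -> odd p != odd q -> J p q = 0.
Proof.
case=> J0 Re Ro Jc; elim/ltn_ind: p q => p IH [|[|q]] pn qn qp pq; [lia|lia|].
rewrite -[LHS]opprK -(Ro q p); [|lia|lia|by move: pq => /=; rewrite negbK eq_sym].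
case: p pn qp pq IH => [|[|p]] pn qp pq IH.
- by case: (J0 q) => ->; rewrite oppr0.
- have [qn1|qn1] := eqVneq q.+1 n.
    rewrite (Ro q 1%N) ?qn1; [|lia|lia|by rewrite eq_sym; move: pq => /=; rewrite negbK].
    by case: (J0 1%N) => _ ->; rewrite oppr0 oppr0.
  by case: (Jc q) => [||-> _]; rewrite ?oppr0 //; lia.
rewrite -(Ro p q); [|lia|lia|by move: pq => /=; rewrite !negbK].
by apply: IH; [lia|lia|lia|lia|move: pq => /=; rewrite !negbK].
Qed.

Lemma cycle_rel0 J p q : cycle_rel J -> (p < n)%N -> (q <= n.+1)%N ->
  q != p.+1 -> (p + q != n)%N || (odd p != odd q) -> J p q = 0.
Proof.
move=> cJ pn qn qp; have [pq /=|npq _] := eqVneq (odd p) (odd q).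
  rewrite orbF neq_ltn => /orP[lt|lt]; first exact: cycle_rel_low.
  exact: cycle_rel_high.
have [lt|ge] := ltnP q p.+1; first exact: cycle_rel_below.
by apply: cycle_rel_above => //; rewrite ltn_neqAle eq_sym qp.
Qed.

Lemma cycle_rel_diag J p p' : cycle_rel J -> (p < n)%N -> (p' < n)%N ->
  J p p.+1 = 0 -> J p' p'.+1 = 0.
Proof.
case=> J0 Re Ro Jc pn p'n Jp.
have step r : (r.+1 < n)%N -> (J r r.+1 == 0) = (J 0%N 1%N == 0).
  elim: r => [//|r IH] rn; rewrite -IH; last by lia.
  by rewrite (Ro r r.+1); [rewrite oppr_eq0|lia|lia|rewrite /=; case: (odd r)].
have diag0 r : (r < n)%N -> (J r r.+1 == 0) = (J 0%N 1%N == 0).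
  case: r => [//|r] rn; rewrite -(step r) //.
  by rewrite (Ro r r.+1); [rewrite oppr_eq0|lia|lia|rewrite /=; case: (odd r)].
by apply/eqP; rewrite diag0 // -(diag0 p) // Jp.
Qed.

(** Since [n] is even, [r] and [n - r] have equal parity, and the antidiagonal walk shows that
    [J r (n - r)] depends only on the parity of [r]. *)
Lemma cycle_rel_anti J p p' : cycle_rel J -> ~~ odd n -> (p < n)%N -> (p' < n)%N ->
  odd p = odd p' -> J p (n - p)%N = 0 -> J p' (n - p')%N = 0.
Proof.
case=> J0 Re Ro Jc n_even pn p'n pp' Jp.
have anti r : (r < n)%N -> J r (n - r)%N = J (odd r) (n - odd r)%N.
  elim/ltn_ind: r => -[|[|r]] IH rn //=; rewrite negbK -IH; [|lia|lia].
  have nr : (n - r = (n - r.+2).+2)%N by lia.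
  have odd_nr : odd (n - r.+2) = odd r.
    by rewrite oddB ?(ltnW rn) // (negPf n_even) /= negbK.
  have [|||_ Er] := Re r (n - r.+2)%N; [lia | lia | by [] |].
  have [|||Er' _] := Re r.+2 (n - r.+2)%N; [lia | lia | by rewrite odd_nr /= negbK |].
  by rewrite nr Er -Er'.
by rewrite anti // -pp' -anti.
Qed.

(* The entries of [J i] can only be nonzero on two "diagonals", along which they
   are constant up to sign; by the symmetry in [i] and [p] each of these
   constants is also an entry of some [J p] lying off both diagonals. *)
Lemma cycle_rel_sym0 (J : nat -> nat -> nat -> V) i p q : (3 <= n)%N ->
  (forall i, (i < n)%N -> cycle_rel (J i)) ->
  (forall i p q, J i p q = J p i q) ->
  (i < n)%N -> (p < n)%N -> (q <= n.+1)%N -> J i p q = 0.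
Proof.
move=> n3 cJ Jsym li pn qn.
have [->|qp] := eqVneq q p.+1.
  (* After exchanging [i] and [r], the entry in row [i] and column [r.+1] is off both diagonals
     exactly when [r] avoids [i] and [n - 1 - i]; one of 0, 1, 2 does. *)
  have [r rn /andP[ri rin]] : exists2 r, (r < n)%N & (r != i) && (r + i != n.-1)%N.
    have [|c0] := boolP ((0 != i) && (0 + i != n.-1))%N; first by exists 0%N => //; lia.
    have [|c1] := boolP ((1 != i) && (1 + i != n.-1))%N; first by exists 1%N => //; lia.
    by exists 2 => //; lia.
  apply: (@cycle_rel_diag _ r) => //; first exact: cJ.
  rewrite Jsym; apply: cycle_rel0 => //; [exact: cJ | lia | lia].
have [/andP[/eqP pqn /eqP pq]|] := boolP ((p + q == n)%N && (odd p == odd q)).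
  have n_even : ~~ odd n by rewrite -pqn oddD pq addbb.
  have -> : q = (n - p)%N by lia.
  (* Here [r] must also have the parity of [p]. As [n] is even, [i] and [n - 1 - i] have opposite
     parities, so at most one of the two candidates is excluded. *)
  have [r /andP[rn /eqP rp] /andP[ri rin]] :
      exists2 r, (r < n)%N && (odd r == odd p) & (r != i) && (r + i != n.-1)%N.
    have [|c0] := boolP ((odd p != i :> nat) && (odd p + i != n.-1))%N.
      by exists (odd p) => //; case: (odd p) => //=; lia.
    exists (odd p).+2; last by case: (odd p) c0 => /=; lia.
    by rewrite /= negbK oddb eqxx andbT; case: (odd p) c0 => /=; lia.
  apply: (@cycle_rel_anti _ r) => //; first exact: cJ.
  rewrite Jsym; apply: cycle_rel0 => //; [exact: cJ | lia | lia | lia].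
by rewrite negb_and; apply: cycle_rel0 => //; exact: cJ.
Qed.
End CycleJacobian.

(** * Surjectivity and vertical prolongation of the cycle bracket *)

Section CycleExample.
Variables (K : fieldType) (m n : nat).
Hypotheses (m3 : (3 <= m)%N) (n3 : (3 <= n)%N).

(* The edges of the n-cycle 0 - 1 - ... - n-1 - 0 are split into the edges
   k - k+1 with k even, those with k odd, and the edge 0 - n-1. *)
Definition cycle_form (a k l : nat) : K :=
  match a with
  | 0 => (odd l && (k.+1 == l))%:R - (odd k && (l.+1 == k))%:R
  | 1 => (~~ odd l && (k.+1 == l))%:R - (~~ odd k && (l.+1 == k))%:R
  | _ => ((k == 0%N) && (l.+1 == n))%:R - ((l == 0%N) && (k.+1 == n))%:R
  end.

(** One edge from each of the three classes; these serve as pivots for the first three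
    components. *)
Definition special_pair (p : 'I_n * 'I_n) : bool :=
  let: (k, l) := p in
  [|| (k == 0 :> nat) && (l == 1 :> nat), (k == 1 :> nat) && (l == 2 :> nat) |
      (k == 0 :> nat) && (l.+1 == n :> nat)].

Definition other_pairs : {set 'I_n * 'I_n} :=
  [set p : 'I_n * 'I_n | (p.1 < p.2)%N && ~~ special_pair p].

Definition cycle_brackets (e : 'I_m -> 'I_n * 'I_n) : bracket_data K m n :=
  fun a => \matrix_(k, l) if (a < 3)%N then cycle_form a k l
                          else ((k, l) == e a)%:R - ((l, k) == e a)%:R.

Lemma card_lt_pairs : #|[set p : 'I_n * 'I_n | (p.1 < p.2)%N]| = 'C(n, 2).
Proof.
rewrite -bin2_sum -sum1_card (eq_bigl (fun p : 'I_n * 'I_n => p.1 < p.2)%N);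
  last by move=> p; rewrite inE.
rewrite -(pair_big_dep xpredT (fun i j : 'I_n => i < j)%N (fun _ _ => 1%N)) /=.
rewrite (exchange_big_dep xpredT) //= big_mkord; apply: eq_bigr => j _.
rewrite sum1_card -[RHS]card_ord
  -[RHS](card_image (f := widen_ord (ltnW (ltn_ord j)))); last first.
  by move=> x y /(congr1 val) /= /val_inj.
apply: eq_card => i; rewrite unfold_in; apply/idP/imageP => [ij|[k _ ->] /=].
  by exists (Ordinal ij) => //; apply: val_inj.
exact: ltn_ord.
Qed.

Lemma card_other_pairs : ('C(n, 2) - 3 <= #|other_pairs|)%N.
Proof.
have [n0 n1 n2 nm] : [/\ 0 < n, 1 < n, 2 < n & n.-1 < n]%N by split; lia.
pose S := [:: (Ordinal n0, Ordinal n1); (Ordinal n1, Ordinal n2); (Ordinal n0, Ordinal nm)].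
have -> : other_pairs = [set p : 'I_n * 'I_n | (p.1 < p.2)%N] :\: [set p | special_pair p].
  by apply/setP => p; rewrite !inE andbC.
rewrite cardsD card_lt_pairs leq_sub2l // (leq_trans (subset_leq_card (subsetIr _ _))) //.
rewrite (leq_trans _ (card_size S)) // subset_leq_card //.
apply/subsetP => -[k l]; rewrite !inE !xpair_eqE -!val_eqE /=.
by lia.
Qed.

Lemma skew_cycle_brackets e : Defs.skew (cycle_brackets e).
Proof.
move=> a; apply/matrixP => k l; rewrite !mxE.
case: ifP => _; rewrite ?opprB //.
by case: (a : nat) => [|[|a']] /=; rewrite ?opprB //.
Qed.

(** Evaluation at a special pair isolates one of the first three coefficients; once these vanish,
    evaluation at [e b] isolates [x b]. *)
Lemma cycle_brackets_free e : {in [pred a : 'I_m | 3 <= a]%N &, injective e} ->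
  (forall a : 'I_m, (3 <= a)%N -> e a \in other_pairs) ->
  injective_at (@bracket_eqs K m n) (coords (cycle_brackets e)).
Proof.
move=> e_inj eP x x0.
have {}x0 (k l : 'I_n) : \sum_a x a * cycle_brackets e a k l = 0.
  by rewrite -[RHS](x0 (k, l)); apply: eq_bigr => a _; rewrite /bracket_eqs coordXE.
have eE (a : 'I_m) (k l : 'I_n) : (3 <= a)%N -> (k < l)%N ->
    cycle_brackets e a k l = ((k, l) == e a)%:R.
  move=> a3 kl; rewrite mxE ltnNge a3 /=; case: ((l, k) =P e a) => [E|]; last by rewrite subr0.
  by have := eP a a3; rewrite -E inE /= ltnNge (ltnW kl).
have spec (b : 'I_m) (k l : 'I_n) : (b < 3)%N -> (k < l)%N -> special_pair (k, l) ->
    (forall a, (a < 3)%N -> cycle_form a k l = (a == b)%:R) -> x b = 0.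
  move=> b3 kl skl cf; rewrite -[RHS](x0 k l) (bigD1 b) //= big1 ?addr0.
    by rewrite mxE b3 cf // eqxx mulr1.
  move=> a ab; have [a3|a3] := ltnP a 3.
    by rewrite mxE a3 cf // val_eqE (negPf ab) mulr0.
  rewrite eE //; case: eqP => [E|_]; last by rewrite mulr0.
  by have := eP a a3; rewrite -E inE skl andbF.
have [n0 n1 n2 nm] : [/\ 0 < n, 1 < n, 2 < n & n.-1 < n]%N by split; lia.
have [E1 E2] : (2 == n)%N = false /\ (1 == n.-1)%N = false by split; lia.
have E3 : (n.-1 == 0)%N = false by lia.
have lt3 (b : 'I_m) : (b < 3)%N -> x b = 0.
  case: b => -[|[|[|//]]] bm _.
  - by apply: (spec _ (Ordinal n0) (Ordinal n1)) => // -[|[|[|]]] //= _; rewrite ?E1 subr0.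
  - by apply: (spec _ (Ordinal n1) (Ordinal n2)) => // -[|[|[|]]] //= _; rewrite subr0.
  - apply: (spec _ (Ordinal n0) (Ordinal nm)) => //=; first by lia.
      by rewrite prednK // eqxx orbT.
    by move=> [|[|[|]]] //= _; rewrite ?prednK ?eqxx ?E2 ?E3 ?andbF ?subr0.
move=> b; have [/lt3 //|b3] := ltnP b 3.
case E: (e b) => [k l]; have := eP b b3; rewrite E inE /= => /andP[kl _].
rewrite -[RHS](x0 k l) (bigD1 b) //= big1 ?addr0; first by rewrite eE // E eqxx mulr1.
move=> a ab; have [/lt3 ->|a3] := ltnP a 3; first by rewrite mul0r.
rewrite eE // -E (inj_in_eq e_inj) ?inE // eq_sym (negPf ab) mulr0 //.
Qed.

Lemma no_vertical_cycle e : no_vertical_prolong (cycle_brackets e).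
Proof.
move=> t tsym tc.
(* The sum picks component [q - 1] of [t i j], and is 0 for [q = 0] or [q > n], matching the shift
   in [cycle_rel]. *)
pose u i j q : K := match insub i, insub j with
  | Some i', Some j' => \sum_(k < n) t i' j' 0 k * (k.+1 == q)%:R | _, _ => 0 end.
have uE (i j : 'I_n) q : u i j q = \sum_(k < n) t i j 0 k * (k.+1 == q)%:R.
  by rewrite /u !valK.
have uS (i j k : 'I_n) : u i j k.+1 = t i j 0 k.
  rewrite uE (bigD1 k) //= eqxx mulr1 big1 ?addr0 // => l.
  by rewrite -val_eqE eqSS => /negPf ->; rewrite mulr0.
have u_out i j q : (q == 0%N) || (n < q)%N -> u i j q = 0.
  rewrite /u; case: insub => // i'; case: insub => // j' q0.
  rewrite big1 // => k _; case: eqP => [kq|_]; last by rewrite mulr0.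
  by have := ltn_ord k; lia.
have usym i j q : u i j q = u j i q.
  by rewrite /u; case: insub => [i'|]; case: insub => [j'|] //; under eq_bigr do rewrite tsym.
(* The neighbours [l - 1] and [l + 1] of the vertex [l] have shifted indices [l] and [l.+2]. *)
have c1 (a b : nat -> bool) (i j l : 'I_n) :
    \sum_k t i j 0 k * ((a l && (k.+1 == l :> nat))%:R - (b k && (l.+1 == k :> nat))%:R) =
    (a l)%:R * u i j l - (b l.+1)%:R * u i j l.+2.
  rewrite !uE !mulr_sumr -sumrB; apply: eq_bigr => k _.
  rewrite mulrBr eqSS -!mulnb !natrM ![_%:R * (t _ _ _ _ * _)]mulrCA.
  by congr (_ - _); rewrite [l.+1 == _]eq_sym; case: eqP => [->|_]; rewrite ?mulr0.
have c3 (i j l : 'I_n) :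
    \sum_k t i j 0 k * (((k == 0%N :> nat) && (l.+1 == n))%:R -
                        ((l == 0%N :> nat) && (k.+1 == n))%:R) =
    (l.+1 == n)%:R * u i j 1%N - (l == 0%N :> nat)%:R * u i j n.
  rewrite !uE !mulr_sumr -sumrB; apply: eq_bigr => k _.
  rewrite mulrBr eqSS -!mulnb !natrM; congr (_ - _); last by rewrite mulrCA.
  by rewrite [LHS]mulrA mulrC.
have form (a : nat) (a3 : (a < 3)%N) (i j l : 'I_n) :
    \sum_k t i j 0 k * cycle_form a k l = \sum_k t i l 0 k * cycle_form a k j.
  have := tc i j l => /rowP/(_ (Ordinal (leq_trans a3 m3))).
  rewrite !brkE.
  by under eq_bigr do rewrite mxE /= a3; under [in RHS]eq_bigr do rewrite mxE /= a3.
have form0 (i j l : 'I_n) :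
    (odd l)%:R * u i j l - (~~ odd l)%:R * u i j l.+2 =
    (odd j)%:R * u i l j - (~~ odd j)%:R * u i l j.+2.
  by have := form 0%N isT i j l; rewrite -!(c1 odd odd).
have form1 (i j l : 'I_n) :
    (~~ odd l)%:R * u i j l - (odd l)%:R * u i j l.+2 =
    (~~ odd j)%:R * u i l j - (odd j)%:R * u i l j.+2.
  have := form 1%N isT i j l; rewrite /cycle_form.
  by rewrite !(c1 (fun k => ~~ odd k) (fun k => ~~ odd k)) /= !negbK.
have form2 (i j l : 'I_n) :
    (l.+1 == n)%:R * u i j 1%N - (l == 0%N :> nat)%:R * u i j n =
    (j.+1 == n)%:R * u i l 1%N - (j == 0%N :> nat)%:R * u i l n.
  by have := form 2 isT i j l; rewrite /cycle_form !c3.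
have cyc i : (i < n)%N -> cycle_rel n (u i).
  move=> ltin; pose i' := Ordinal ltin.
  split.
  - by move=> p; rewrite !u_out ?ltnSn ?orbT.
  - move=> j l jn ln jl.
    have := form0 i' (Ordinal jn) (Ordinal ln).
    have := form1 i' (Ordinal jn) (Ordinal ln).
    rewrite /= -jl; case: (odd j); rewrite /= ?mul1r ?mul0r ?subr0 ?sub0r.
      by move=> /oppr_inj E1 E0.
    by move=> E1 /oppr_inj E0.
  - move=> j l jn ln jl.
    have := form0 i' (Ordinal jn) (Ordinal ln).
    have := form1 i' (Ordinal jn) (Ordinal ln).
    rewrite /=; move: jl; case: (odd j); case: (odd l) => //= _;
      by rewrite ?mul1r ?mul0r ?subr0 ?sub0r => E1 E0.
  - move=> j j0 jn.
    have n1 : (n.-1 < n)%N by lia.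
    have n0 : (0 < n)%N by lia.
    have jn' : (j < n)%N by lia.
    (* The closing edge meets only the vertices 0 and [n - 1]; pairing an inner [j] with each of
       them isolates one end component. *)
    have := form2 i' (Ordinal jn') (Ordinal n1).
    have := form2 i' (Ordinal jn') (Ordinal n0).
    rewrite /= prednK // eqxx.
    have -> : (j.+1 == n)%N = false by lia.
    have -> : (j == 0)%N = false by lia.
    have -> : (n.-1 == 0)%N = false by lia.
    have -> : (1 == n)%N = false by lia.
    by rewrite !mul0r !mul1r !subr0 sub0r => /eqP; rewrite oppr_eq0 => /eqP.
move=> i j; apply/rowP => k; rewrite [RHS]mxE -uS.
by apply: (cycle_rel_sym0 n3 cyc) => //; have := ltn_ord k; lia.
Qed.

Lemma generic_rigid_char0 : (m <= 'C(n, 2))%N -> (forall j, j.+1%:R != 0 :> K) ->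
  generic_rigid K m n.
Proof.
move=> m_le char0.
have n0 : (0 < n)%N by lia.
(* Subtraction truncates below 3, so [e] is only claimed injective from 3 on. *)
pose e (a : 'I_m) := nth (Ordinal n0, Ordinal n0) (enum other_pairs) (a - 3).
have lt_e (a : 'I_m) : (3 <= a)%N -> (a - 3 < size (enum other_pairs))%N.
  by move=> a3; rewrite -cardE; have := card_other_pairs; have := ltn_ord a; lia.
apply: (@generic_rigid_of_example _ _ _ (cycle_brackets e)) => //.
- exact: skew_cycle_brackets.
- apply: cycle_brackets_free => [a b|a a3]; last by rewrite -mem_enum mem_nth ?lt_e.
  rewrite !inE => a3 b3 /eqP; rewrite nth_uniq ?enum_uniq ?lt_e // => /eqP ab.
  by apply: val_inj => /=; lia.
exact: no_vertical_cycle.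
Qed.
End CycleExample.

(* Over R (any realType, i.e. the real numbers) and over C = R[i]. *)
Theorem theorem5p1 (R : realType) (m n : nat) :
  (3 <= m)%N -> (3 <= n)%N -> (m <= 'C(n, 2))%N ->
  generic_rigid R m n /\ generic_rigid (R[i])%C m n.
Proof.
by move=> m3 n3 m_le; split; apply: generic_rigid_char0 => // j; rewrite pnatr_eq0.
Qed.
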